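(* For each fixed $k\ge3$, the probability that a uniformly random standard Young tableau with $n$ cells has the entry $k$ in row $1$, column $2$ equals \[\frac{k-1}{k!}+\frac{k-4}{3(k-3)!}\,\frac1{n^{3/2}}+O\!\left(\frac1{n^2}\right)\qquad(n\to\infty).\]
   Context: A standard Young tableau with $n$ cells is a Ferrers diagram of a partition of $n$ filled bijectively with $1,\dots,n$, entries increasing along rows and down columns; the uniform distribution is over all such tableaux of all shapes with $n$ cells. *)

(* Defs.v *)
From mathcomp Require Import all_boot.
From Stdlib Require Import Reals.

Set Implicit Arguments.
Unset Strict Implicit.
Unset Printing Implicit Defensive.

(* A filling of n cells: entry a : 'I_n (standing for the number a+1) is placed
   in cell (row, column) = f a, rows and columns 0-indexed (row 0 = top row,
   English convention). Cell coordinates of a Ferrers diagram with n cells are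
   always < n, so the codomain 'I_n * 'I_n loses nothing. *)
Definition cell_of n (f : {ffun 'I_n -> 'I_n * 'I_n}) (a : 'I_n) : nat * nat :=
  (val (f a).1, val (f a).2).

Definition is_SYT n (f : {ffun 'I_n -> 'I_n * 'I_n}) : bool :=
  [&& injectiveb f,
      [forall a : 'I_n,
         ((0 < (cell_of f a).1) ==>
            [exists b : 'I_n, cell_of f b == ((cell_of f a).1.-1, (cell_of f a).2)])
         && ((0 < (cell_of f a).2) ==>
            [exists b : 'I_n, cell_of f b == ((cell_of f a).1, (cell_of f a).2.-1)])]
    & [forall a : 'I_n, forall b : 'I_n,
         ((cell_of f b == ((cell_of f a).1, (cell_of f a).2.+1)) ==> (a < b))
         && ((cell_of f b == ((cell_of f a).1.+1, (cell_of f a).2)) ==> (a < b))]].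

Definition num_SYT n : nat := #|[set f : {ffun 'I_n -> 'I_n * 'I_n} | is_SYT f]|.

Definition num_SYT_k12 n k : nat :=
  #|[set f : {ffun 'I_n -> 'I_n * 'I_n} | is_SYT f &&
       [exists a : 'I_n, (val a == k.-1) && (cell_of f a == (0, 1))]]|.

Definition prob_k12 (n k : nat) : R := (INR (num_SYT_k12 n k) / INR (num_SYT n))%R.

(* Main.v *)
(** Reading off the rows of 1, ..., n turns tableaux into ballot words, i.e. into
    upward paths in Young's lattice from the empty shape.  If k >= 3 sits in row 1,
    column 2, then 1, ..., k-1 fill the first column, so the favourable tableaux
    correspond to upward paths of length m = n - k from the hook (2,1^(k-2)).

    The relation DU - UD = 1 of Young's lattice yields, for every shape l, that the
    number of upward paths of length m from l is
      sum_j C(m,j) a_j(l) t_(m-j),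
    where a_j(l) counts the downward paths of length j and t_n is the number of
    involutions (and of tableaux with n cells).  For the hook, a_j is k-1 for
    j = k, k-1, k-2 and k-2 for j = k-3.  The recurrence t_(n+1) = t_n + n t_(n-1)
    likewise gives t_n = sum_j C(m,j) (k)_j t_(k-j) t_(m-j).

    With E_j = (m)_j t_(m-j) / t_n, the second identity expresses 1, and the first one
    the probability, as a combination of E_0, ..., E_k; subtracting (k-1)/k! times the
    second cancels the terms j = k, k-1, k-2 and leaves the coefficient
    (k-4)/(3(k-3)!) on E_(k-3).  Finally sqrt n <= t_n / t_(n-1) <= sqrt n + 1 gives
    E_(k-i) = n^(-i/2) (1 + O(n^(-1/2))). *)
Require Import Defs.
From mathcomp Require Import all_boot.
From mathcomp Require Import zify.
From Stdlib Require Import Reals Lra FunctionalExtensionality.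

Set Implicit Arguments.
Unset Strict Implicit.
Unset Printing Implicit Defensive.

(** * Counting paths in Young's lattice *)

Fixpoint invol (n : nat) : nat :=
  match n with
  | 0 => 1
  | p.+1 => if p is q.+1 then invol p + p * invol q else 1
  end.

Lemma involS n : invol n.+1 = invol n + n * invol n.-1.
Proof. by case: n. Qed.

Lemma invol_gt0 n : 0 < invol n.
Proof. by elim: n => // n IH; rewrite involS addn_gt0 IH. Qed.

(* The coefficient of [z^m/m!] in [exp (z x + z + z^2/2)], with [x^j] replaced by [a j]. *)
Definition hermite (m : nat) (a : nat -> nat) : nat :=
  \sum_(j < m.+1) 'C(m, j) * a j * invol (m - j).

(** With [a j] standing for x^j, this is the image of x^j under x + 1 + d/dx, the operator that d/dz
    induces on exp(zx + z + z^2/2). *)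
Definition raise (a : nat -> nat) (j : nat) : nat := a j.+1 + a j + j * a j.-1.

(** Differentiation of the generating function in z, done on coefficients: Pascal's rule yields the
    [a j.+1], the recurrence of [invol] the [a j], and (m-j) C(m,j) = (j+1) C(m,j+1) the
    [j * a j.-1]. *)
Lemma hermiteS m a : hermite m.+1 a = hermite m (raise a).
Proof.
rewrite /hermite big_ord_recl /= bin0 mul1n ?subn0.
rewrite (eq_bigr (fun j : 'I_m.+1 => 'C(m, j.+1) * a j.+1 * invol (m - j)
   + 'C(m, j) * a j.+1 * invol (m - j))); last first.
  by move=> j _; rewrite /bump /= add1n binS subSS !mulnDl.
rewrite big_split /= addnA.
have -> : a 0 * invol m.+1 + \sum_(j < m.+1) 'C(m, j.+1) * a j.+1 * invol (m - j)
  = \sum_(j < m.+1) 'C(m, j) * a j * invol (m.+1 - j).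
  rewrite big_ord_recr /= bin_small // !mul0n addn0.
  by rewrite [RHS]big_ord_recl /= bin0 mul1n ?subn0; congr (_ + _).
rewrite [X in X + _](eq_bigr (fun j : 'I_m.+1 => 'C(m, j) * a j * invol (m - j)
   + 'C(m, j) * (m - j) * a j * invol (m - j).-1)); last first.
  move=> j _. rewrite subSn; last by rewrite -ltnS.
  rewrite involS; lia.
rewrite big_split /=.
have -> : \sum_(j < m.+1) 'C(m, j) * (m - j) * a j * invol (m - j).-1
  = \sum_(j < m.+1) 'C(m, j) * (j * a j.-1) * invol (m - j).
  rewrite big_ord_recr /= subnn muln0 !mul0n addn0.
  rewrite [RHS]big_ord_recl /= mul0n muln0 mul0n add0n.
  apply: eq_bigr => j _; rewrite /bump /= add1n.
  rewrite mulnA (mulnC _ j.+1) mul_bin_left (mulnC _ (m - j)).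
  by congr (_ * _ * invol _); lia.
rewrite -!big_split /=; apply: eq_bigr => j _; rewrite /raise; lia.
Qed.

Lemma eq_hermite m a b : a =1 b -> hermite m a = hermite m b.
Proof. by move=> e; apply: eq_bigr => j _; rewrite e. Qed.

Lemma hermite_trunc m k a : k <= m -> (forall j, k < j -> a j = 0) ->
  hermite m a = \sum_(j < k.+1) 'C(m, j) * a j * invol (m - j).
Proof.
move=> lekm a0; rewrite /hermite.
rewrite -!(big_mkord xpredT (fun j => 'C(m, j) * a j * invol (m - j))).
rewrite (@big_cat_nat _ _ _ k.+1) //= -[RHS]addn0; congr (_ + _).
rewrite big_nat big1 //.
by move=> j /andP[/a0-> _]; rewrite muln0.
Qed.

Lemma hermite_delta0 m : hermite m (fun j => j == 0) = invol m.
Proof.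
rewrite (@hermite_trunc m 0) //; last by case.
by rewrite big_ord1 bin0 subn0 !mul1n.
Qed.

(** Induction on k: [raise] carries the sequence for k to that for k+1. Combinatorially, j is the
    number of 2-cycles joining the block of m points to the block of k points. *)
Lemma invol_add m k :
  invol (m + k) = hermite m (fun j => k ^_ j * invol (k - j)).
Proof.
elim: k m => [|k IH] m.
  rewrite addn0 -hermite_delta0; apply: eq_hermite => -[|j] //=.
rewrite addnS -addSn IH hermiteS; apply: eq_hermite => j; rewrite /raise.
have e : k.+1 ^_ j = k ^_ j + j * k ^_ j.-1.
  case: j => [|j] /=; first by rewrite !ffactn0.
  rewrite ffactSS ffactnSr (mulnC _ (k - j)) -mulnDl.
  have [lejk|ltkj] := leqP j k; last by rewrite ffact_small ?muln0.
  by congr (_ * _); lia.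
rewrite e ffactnSr.
(* Truncated subtraction forces the cases j < k, j = k and j > k; only in the first can the
   recurrence be applied to [invol (k.+1 - j)]. *)
have [ltjk|] := ltnP j k.
  have -> : k.+1 - j = (k - j).+1 by lia.
  rewrite involS; case: j ltjk {e} => [|j] ltjk.
    by rewrite !ffactn0 !subn0 /= subn1; lia.
  have -> : k - j.+2 = (k - j.+1).-1 by lia.
  have -> : k - j.+1.-1 = (k - j.+1).+1 by move=> /=; lia.
  rewrite involS; lia.
rewrite leq_eqVlt => /orP[/eqP<-|ltkj].
  rewrite !subnn muln0 mul0n !add0n subSnn /=.
  case: k {IH e} => [|k] //=; rewrite subSnn /=; lia.
rewrite ffact_small // !mul0n !add0n.
have -> : k - j.-1 = 0 by lia.
have -> : k.+1 - j = 0 by lia.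
by rewrite mulnA.
Qed.

(** * Shapes, their corners and the paths between them *)

Definition incr (i : nat) (l : nat -> nat) : nat -> nat := fun x => l x + (x == i).
Definition decr (i : nat) (l : nat -> nat) : nat -> nat := fun x => l x - (x == i).
Definition addable (l : nat -> nat) (i : nat) : bool := (i == 0) || (l i < l i.-1).
Definition removable (l : nat -> nat) (i : nat) : bool := l i.+1 < l i.
Definition nonincr (l : nat -> nat) : Prop := forall i, l i.+1 <= l i.

(* Shapes are row-length functions; [N] only bounds the rows that may be changed, and is
   irrelevant as soon as it exceeds every row reached. *)
Fixpoint ups (N m : nat) (l : nat -> nat) : nat :=
  if m is p.+1 then \sum_(i < N | addable l i) ups N p (incr i l) else 1.

Fixpoint downs (N j : nat) (l : nat -> nat) : nat :=
  if j is p.+1 then \sum_(i < N | removable l i) downs N p (decr i l) else 1.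

Lemma incrK i : cancel (incr i) (decr i).
Proof. by move=> l; apply: functional_extensionality => x; rewrite /decr /incr addnK. Qed.

Lemma decrK i l : removable l i -> incr i (decr i l) = l.
Proof.
rewrite /removable => h; apply: functional_extensionality => x; rewrite /decr /incr.
by case: eqP => [->|]; lia.
Qed.

Lemma incr_decrC i j l : i != j -> incr i (decr j l) = decr j (incr i l).
Proof.
by move=> h; apply: functional_extensionality => x; rewrite /decr /incr; lia.
Qed.

Lemma nonincr_incr l i : nonincr l -> addable l i -> nonincr (incr i l).
Proof.
move=> h; rewrite /addable /incr => a x; have := h x.
case: i a => [|i] /=; first lia.
by rewrite eqSS; case: (x =P i) => [->|]; lia.
Qed.

Lemma nonincr_decr l i : nonincr l -> removable l i -> nonincr (decr i l).
Proof.
move=> h; rewrite /removable /decr => a x; have := h x; have := h i.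
by case: (x =P i) => [->|] /=; lia.
Qed.

(** Row i+1 can grow exactly when row i can shrink, row 0 can always grow, and the empty row N
    cannot shrink. *)
Lemma sum_addable l N : l N = 0 ->
  \sum_(i < N.+1 | addable l i) 1 = (\sum_(i < N.+1 | removable l i) 1).+1.
Proof.
move=> l0; rewrite big_mkcond big_ord_recl /=.
rewrite [X in _ = X.+1]big_mkcond big_ord_recr /= {2}/removable l0 ltn0 addn0 add1n.
by congr _.+1; apply: eq_bigr => i _; rewrite /bump /= add1n.
Qed.

Lemma removable_incr l i : nonincr l -> removable (incr i l) i.
Proof. by move=> h; rewrite /removable /incr; have := h i; lia. Qed.

Lemma addable_decr l i : nonincr l -> removable l i -> addable (decr i l) i.
Proof.
rewrite /removable /addable /decr => h; case: i => //= i.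
by have := h i; lia.
Qed.

Lemma addable_removableC l i j : nonincr l -> removable l j -> i != j ->
  addable l i && removable (incr i l) j = addable (decr j l) i.
Proof.
rewrite /addable /removable /incr /decr => h.
case: i => [|i] /=; last (have := h i; have := h j).
  by lia.
by case: (i =P j) => [->|]; lia.
Qed.

Lemma addable_removable l i j : nonincr l -> addable l i -> removable (incr i l) j ->
  j != i -> removable l j.
Proof.
rewrite /addable /removable /incr => h; have := h j.
by lia.
Qed.

(* This is the relation [DU - UD = 1] of a differential poset. *)
Lemma up_down_comm N l (F : (nat -> nat) -> nat) : nonincr l -> l N = 0 ->
  \sum_(i < N.+1 | addable l i)
     \sum_(j < N.+1 | removable (incr i l) j) F (decr j (incr i l))
  = F l + \sum_(j < N.+1 | removable l j)
     \sum_(i < N.+1 | addable (decr j l) i) F (incr i (decr j l)).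
Proof.
move=> h l0.
rewrite (eq_bigr (fun i : 'I_N.+1 => F l +
  \sum_(j < N.+1 | removable (incr i l) j && (j != i)) F (decr j (incr i l)))); last first.
  by move=> i ai; rewrite (bigD1 i) /= ?removable_incr // incrK.
rewrite [in RHS](eq_bigr (fun j : 'I_N.+1 => F l +
  \sum_(i < N.+1 | addable (decr j l) i && (i != j)) F (incr i (decr j l)))); last first.
  by move=> j rj; rewrite (bigD1 j) /= ?addable_decr // decrK.
(* The diagonal terms number one per addable row on the left and one per removable row on the right,
   so a single [F l] remains; off the diagonal the two moves commute. *)
rewrite !big_split /= addnA; congr (_ + _).
  have := sum_addable l0; rewrite !sum1_card !sum_nat_const => ->.
  by rewrite mulSn.
rewrite (exchange_big_dep (fun j : 'I_N.+1 => removable l j)) /=; last first.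
  by move=> i j ai /andP[]; apply: addable_removable.
apply: eq_bigr => j rj; apply: eq_big => i.
  rewrite andbA; case: (eqVneq j i) => [->|ne]; first by rewrite !andbF.
  by rewrite !andbT addable_removableC // eq_sym.
by case/andP=> _ /andP[_ ne]; rewrite incr_decrC // eq_sym.
Qed.

(** Moving the addition past the j removals costs j copies of [downs N.+1 j.-1 l]; once it comes
    last, counting addable rows as removable rows plus one gives the other two terms. *)
Lemma sum_downs_incr N j l : nonincr l -> l N = 0 ->
  \sum_(i < N.+1 | addable l i) downs N.+1 j (incr i l)
  = raise (fun j => downs N.+1 j l) j.
Proof.
elim: j l => [|j IH] l h l0; rewrite /raise.
  by rewrite mul0n addn0 /= sum_addable // addn1.
rewrite [in LHS]/= up_down_comm //.
rewrite (eq_bigr (fun i : 'I_N.+1 => downs N.+1 j.+1 (decr i l) +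
    downs N.+1 j (decr i l) + j * downs N.+1 j.-1 (decr i l))); last first.
  move=> i ri; rewrite IH //; first exact: nonincr_decr.
  by rewrite /decr l0.
rewrite !big_split /= mulSn -big_distrr /=.
case: j {IH} => [|j] /=; lia.
Qed.

(** An upward step applies [raise] to the downward counts, which is the recursion [hermiteS]. A step
    opens at most one new row, so [r + m <= N.+1] keeps the bound on rows from interfering. *)
Lemma ups_hermite N m r l : nonincr l -> (forall i, r <= i -> l i = 0) -> r + m <= N.+1 ->
  ups N.+1 m l = hermite m (fun j => downs N.+1 j l).
Proof.
elim: m r l => [|m IH] r l h l0 le.
  by rewrite /hermite big_ord1.
rewrite hermiteS /=.
rewrite (eq_bigr (fun i : 'I_N.+1 => hermite m (fun j => downs N.+1 j (incr i l)))); last first.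
  move=> i ai; apply: (IH r.+1); [exact: nonincr_incr | | lia].
  move=> x lex; rewrite /incr l0; last by lia.
  suff : (i : nat) <= r by case: eqP => //=; lia.
  move: ai; rewrite /addable => /orP[/eqP->//|].
  by case: (leqP i r) => // lti; rewrite [l i.-1]l0 //; lia.
rewrite /hermite exchange_big /=; apply: eq_bigr => j _.
rewrite -sum_downs_incr //; last by rewrite l0; lia.
by rewrite -big_distrl -big_distrr.
Qed.

(** * Downward paths from columns and hooks *)

Definition column (r : nat) : nat -> nat := fun i => i < r.
(* The shape (2,1^(r-1)) when [0 < r]. *)
Definition hook (r : nat) : nat -> nat := incr 0 (column r).

Lemma removable_column r i : removable (column r) i = (i.+1 == r).
Proof. by rewrite /removable /column; lia. Qed.

Lemma downs_column N r j : r <= N -> downs N j (column r) = (j <= r).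
Proof.
elim: j r => //= j IH [|r] lerN.
  by rewrite big1 // => i; rewrite removable_column.
rewrite (big_pred1 (Ordinal lerN)); last first.
  by move=> i; rewrite /= removable_column eqSS.
rewrite ltnS -IH; last exact: ltnW.
congr downs; apply: functional_extensionality => x; rewrite /decr /column /=; lia.
Qed.

Lemma removable_hook r i : 0 < r ->
  removable (hook r) i = (i == 0) || (i == r.-1).
Proof. by move=> h; rewrite /removable /hook /incr /column; lia. Qed.

Lemma decr0_hook r : decr 0 (hook r) = column r.
Proof. exact: incrK. Qed.

(** A downward path is determined by the moment, if any, at which the second box of the top row
    goes; it must go before the last box of the first column. *)
Lemma downs_hook N r j : 0 < r <= N ->
  downs N j (hook r) = if j < r then j.+1 else if j <= r.+1 then r else 0.
Proof.
elim: j r => [|j IH] r; first by case: r.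
case/andP=> r0 leN /=; have N0 : 0 < N by lia.
rewrite (bigD1 (Ordinal N0)) /=; last by rewrite removable_hook.
rewrite decr0_hook downs_column //.
case: r r0 leN => [|[|r]] // _ leN.
  (* For r = 1 the shape is (2), and its two candidate corners coincide. *)
  rewrite big1 ?addn0; first by case: j {IH} => [|[]].
  by move=> i; rewrite removable_hook //= orbb -val_eqE /= => /andP[->].
rewrite (big_pred1 (Ordinal leN)); last first.
  by move=> i; rewrite removable_hook //= -!val_eqE /=; lia.
have -> : decr (Ordinal leN) (hook r.+2) = hook r.+1.
  by apply: functional_extensionality => x; rewrite /decr /hook /incr /column /=; lia.
rewrite IH; last by lia.
by do ![case: ifP]; lia.
Qed.

(** * Tableaux as ballot words *)

Fixpoint ballot (l : nat -> nat) (s : seq nat) : bool :=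
  if s is i :: s' then addable l i && ballot (incr i l) s' else true.

Lemma ballotP l s :
  reflect (forall j, j < size s ->
             addable (fun i => l i + count_mem i (take j s)) (nth 0 s j))
          (ballot l s).
Proof.
elim: s l => [|x s IH] l /=; first by constructor.
have E j : (fun i => incr x l i + count_mem i (take j s)) =
           (fun i => l i + count_mem i (take j.+1 (x :: s))).
  apply: functional_extensionality => i; rewrite /incr /=.
  by rewrite addnA [i == x]eq_sym.
apply: (iffP andP) => [[ax /IH b] [|j] //= lt|b].
- by move: ax; rewrite /addable /= !addn0.
- by have := b j lt; rewrite E.
split; first by have := b 0 isT; rewrite /addable /= !addn0.
by apply/IH => j lt; rewrite E; apply: (b j.+1).
Qed.

Lemma ballot_cat l s s' :
  ballot l (s ++ s') = ballot l s && ballot (foldl (fun l i => incr i l) l s) s'.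
Proof. by elim: s l => //= i s IH l; rewrite IH andbA. Qed.

Lemma card_tuple_cons (T : finType) m (P : pred (m.+1.-tuple T)) :
  #|[set t | P t]| = \sum_(x : T) #|[set t : m.-tuple T | P [tuple of x :: t]]|.
Proof.
rewrite -sum1_card (eq_bigl P); last by move=> t; rewrite inE.
rewrite (reindex (fun u : T * m.-tuple T => [tuple of u.1 :: u.2])) /=; last first.
  exists (fun t : m.+1.-tuple T => (thead t, [tuple of behead t])) => [[x t] _|t _] /=.
    by congr pair; apply: val_inj.
  by rewrite -tuple_eta.
rewrite -(pair_big_dep xpredT (fun x (t : m.-tuple T) => P [tuple of x :: t])
  (fun _ _ => 1)) /=.
by apply: eq_bigr => x _; rewrite -sum1_card; apply: eq_bigl => t; rewrite inE.
Qed.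

Lemma card_ballot N m l :
  #|[set t : m.-tuple 'I_N | ballot l (map val t)]| = ups N m l.
Proof.
elim: m l => [|m IH] l /=.
  rewrite -[RHS](card_tuple 0 'I_N) -cardsT; apply: eq_card => t.
  by rewrite !inE tuple0.
rewrite card_tuple_cons [RHS]big_mkcond; apply: eq_bigr => x _ /=.
case: (addable l x); first exact: IH.
by apply: eq_card0 => t; rewrite inE.
Qed.

Lemma card_ballot_prefix N n m l (p : seq nat) : n = size p + m -> all (fun i => i < N) p ->
  ballot l p ->
  #|[set t : n.-tuple 'I_N | ballot l (map val t) && prefix p (map val t)]|
  = ups N m (foldl (fun l i => incr i l) l p).
Proof.
elim: p n l => [|i p IH] [|n] l //= en.
- by move=> _ _; rewrite -[m]en -card_ballot; apply: eq_card => t; rewrite !inE prefix0s andbT.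
- by move=> _ _; rewrite add0n in en; rewrite -en -card_ballot; apply: eq_card => t; rewrite !inE prefix0s andbT.
move=> /andP[ltiN ap] /andP[ai bp].
rewrite card_tuple_cons (bigD1 (Ordinal ltiN)) //= eqxx ai /=.
rewrite IH //; last by move: en; rewrite addSn => -[].
rewrite big1 ?addn0 // => j ne; apply: eq_card0 => t; rewrite inE.
suff -> : (i == j) = false by rewrite andbF.
by apply/negbTE; apply: contra ne => /eqP e; apply/eqP/val_inj.
Qed.

Lemma leq_count_take (s : seq nat) r b a : b <= a ->
  count_mem r (take b s) <= count_mem r (take a s).
Proof.
move=> le; rewrite -{1}(minn_idPl le) take_min.
by rewrite -[X in _ <= count_mem r X](cat_take_drop b) count_cat leq_addr.
Qed.

Lemma count_takeS (s : seq nat) r b : b < size s ->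
  count_mem r (take b.+1 s) = count_mem r (take b s) + (nth 0 s b == r).
Proof. by move=> lt; rewrite (take_nth 0) // -cats1 count_cat /= addn0. Qed.

Lemma ltn_count_take (s : seq nat) b a : b < a -> a <= size s ->
  count_mem (nth 0 s b) (take b s) < count_mem (nth 0 s b) (take a s).
Proof.
move=> lt le; apply: leq_trans (leq_count_take _ _ lt).
by rewrite count_takeS ?eqxx ?addn1 //; apply: leq_trans le.
Qed.

(** Prefix counts start at 0 and grow by at most one per letter, so the passage from [c] to [c + 1]
    happens at some position. This locates the entry that fills a prescribed cell. *)
Lemma count_take_ivt (s : seq nat) r a c : a <= size s -> c < count_mem r (take a s) ->
  exists b, [/\ b < a, nth 0 s b = r & count_mem r (take b s) = c].
Proof.
elim: a => [|a IH] le; first by rewrite take0.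
rewrite count_takeS //; have [lt _|le' lt] := ltnP c (count_mem r (take a s)).
  by have [|b [? ? ?]] := IH _ lt; [exact: ltnW | exists b; split=> //; apply: ltnW].
exists a; case: (nth 0 s a =P r) lt; first by split => //; lia.
by rewrite addn0; lia.
Qed.

(** * From tableaux to ballot words *)

Section Tableau.

Variables (n : nat) (f : {ffun 'I_n -> 'I_n * 'I_n}).

Definition row_word : n.-tuple 'I_n := [tuple (f a).1 | a < n].

Lemma size_row_word : size (map val row_word) = n.
Proof. by rewrite size_map size_tuple. Qed.

Lemma nth_row_word (a : 'I_n) : nth 0 (map val row_word) a = (cell_of f a).1.
Proof.
rewrite (nth_map (f a).1) ?size_tuple // /cell_of.
by rewrite -tnth_nth tnth_mktuple.
Qed.

Hypothesis fS : is_SYT f.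

Lemma SYT_inj a b : cell_of f a = cell_of f b -> a = b.
Proof.
case/and3P: fS => /injectiveP inj _ _ [/val_inj e1 /val_inj e2].
by apply: inj; rewrite [f a]surjective_pairing [f b]surjective_pairing e1 e2.
Qed.

(** [is_SYT] relates adjacent cells only; iterating to the left reaches all earlier columns. *)
Lemma SYT_left a c : c < (cell_of f a).2 ->
  exists2 b, cell_of f b = ((cell_of f a).1, c) & b < a.
Proof.
case/and3P: (fS) => _ /forallP down /forallP ord.
move: {2}(cell_of f a).2 (leqnn (cell_of f a).2) => d; elim: d a => [|d IH] a led ltc.
  by lia.
case/andP: (down a) => _ /implyP /(_ (leq_ltn_trans (leq0n _) ltc)) /existsP[b /eqP eb].
have ltba : b < a.
  have /forallP/(_ a)/andP[/implyP h _] := ord b.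
  by apply: h; rewrite eb /= prednK ?(leq_ltn_trans (leq0n _) ltc) // -surjective_pairing.
have [ec|nc] := eqVneq c (cell_of f b).2.
  by exists b => //; rewrite ec [LHS]surjective_pairing {1}eb.
have eb2 : (cell_of f b).2 = (cell_of f a).2.-1 by rewrite eb.
have [||b' eb' lt'] := IH b; [lia..|].
exists b'; last exact: ltn_trans ltba.
by rewrite eb' eb.
Qed.

Lemma SYT_up a r : r < (cell_of f a).1 ->
  exists2 b, cell_of f b = (r, (cell_of f a).2) & b < a.
Proof.
case/and3P: (fS) => _ /forallP down /forallP ord.
move: {2}(cell_of f a).1 (leqnn (cell_of f a).1) => d; elim: d a => [|d IH] a led ltc.
  by lia.
case/andP: (down a) => /implyP /(_ (leq_ltn_trans (leq0n _) ltc)) /existsP[b /eqP eb] _.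
have ltba : b < a.
  have /forallP/(_ a)/andP[_ /implyP h] := ord b.
  by apply: h; rewrite eb /= prednK ?(leq_ltn_trans (leq0n _) ltc) // -surjective_pairing.
have [ec|nc] := eqVneq r (cell_of f b).1.
  by exists b => //; rewrite ec [LHS]surjective_pairing {2}eb.
have eb2 : (cell_of f b).1 = (cell_of f a).1.-1 by rewrite eb.
have [||b' eb' lt'] := IH b; [lia..|].
exists b'; last exact: ltn_trans ltba.
by rewrite eb' eb.
Qed.

(** Strong induction on [a]. Were the column too large, the cell of that row in the column given by
    the count would hold a smaller entry with a smaller count; were it too small, an earlier entry
    would already occupy the cell of [a]. *)
Lemma SYT_col (a : 'I_n) :
  (cell_of f a).2 = count_mem (cell_of f a).1 (take a (map val row_word)).
Proof.
have [d] := ubnP a; elim: d a => // d IH a lead; set s := map val _.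
have les (x : 'I_n) : x <= size s by rewrite size_row_word ltnW.
apply/eqP; rewrite eqn_leq; apply/andP; split; rewrite leqNgt; apply/negP => lt.
  have [b eb ltba] := SYT_left lt.
  have := IH b (leq_trans ltba lead); rewrite eb /= -/s.
  have := @ltn_count_take s b a ltba (les a); rewrite nth_row_word eb /=; lia.
have [b [ltba eb cb]] := count_take_ivt (les a) lt.
have ltbn : b < n by apply: ltn_trans ltba _.
have := IH (Ordinal ltbn) (leq_trans ltba lead).
rewrite -nth_row_word -[nat_of_ord (Ordinal _)]/b -/s eb cb => e.
suff e' : Ordinal ltbn = a by move: ltba; rewrite -e' /= ltnn.
apply: SYT_inj; rewrite [LHS]surjective_pairing [RHS]surjective_pairing e.
by rewrite -(nth_row_word (Ordinal ltbn)) /= -/s eb.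
Qed.

(** The cell above that of [a] holds a smaller entry in the same column; as columns are counts, the
    row above has strictly more letters before [a]. *)
Lemma ballot_row_word : ballot (column 0) (map val row_word).
Proof.
apply/ballotP => j; rewrite size_row_word => ltjn.
rewrite -[j]/(val (Ordinal ltjn)); move: (Ordinal ltjn) => a.
rewrite nth_row_word /addable /column; case E : (cell_of f a).1 => [//|r].
rewrite [_ == 0]/= [_ < 0]/= !add0n /= -E -SYT_col.
have [|b eb ltba] := @SYT_up a r; first by rewrite E.
have := SYT_col b; rewrite eb /= => ->.
have := @ltn_count_take (map val row_word) b a ltba.
by rewrite nth_row_word eb /= size_row_word; apply; apply: ltnW.
Qed.

End Tableau.

Lemma row_word_inj n (f g : {ffun 'I_n -> 'I_n * 'I_n}) :
  is_SYT f -> is_SYT g -> row_word f = row_word g -> f = g.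
Proof.
move=> fS gS e; apply/ffunP => a.
have : cell_of f a = cell_of g a.
  rewrite [LHS]surjective_pairing [RHS]surjective_pairing.
  by rewrite (SYT_col fS) (SYT_col gS) -!nth_row_word e.
case=> /val_inj e1 /val_inj e2.
by rewrite [f a]surjective_pairing [g a]surjective_pairing e1 e2.
Qed.

(** * From ballot words back to tableaux *)

Lemma col_proof n (t : n.-tuple 'I_n) (a : 'I_n) :
  count_mem (nth 0 (map val t) a) (take a (map val t)) < n.
Proof.
apply: leq_ltn_trans (count_size _ _) _.
by rewrite size_takel ?size_map ?size_tuple // ltnW.
Qed.

(** The column is the one forced by [SYT_col], so no other inverse of [row_word] is possible. *)
Definition tableau_of n (t : n.-tuple 'I_n) : {ffun 'I_n -> 'I_n * 'I_n} :=
  [ffun a => (tnth t a, Ordinal (col_proof t a))].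

Lemma tableau_ofK n (t : n.-tuple 'I_n) : row_word (tableau_of t) = t.
Proof. by apply: eq_from_tnth => a; rewrite tnth_mktuple ffunE. Qed.

Lemma cell_tableau_of n (t : n.-tuple 'I_n) a (s := map val t) :
  cell_of (tableau_of t) a = (nth 0 s a, count_mem (nth 0 s a) (take a s)).
Proof.
by rewrite /cell_of ffunE /s /= (nth_map a) ?size_tuple // -tnth_nth.
Qed.

(** [count_take_ivt] supplies the left neighbour, as columns are counts, and the upper one, by the
    ballot condition. The order follows from monotonicity of prefix counts, with the ballot
    condition again for columns. *)
Lemma tableau_of_SYT n (t : n.-tuple 'I_n) :
  ballot (column 0) (map val t) -> is_SYT (tableau_of t).
Proof.
move=> /ballotP bt; set s := map val t in bt.
have szs : size s = n by rewrite size_map size_tuple.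
have les (x : 'I_n) : x <= size s by rewrite szs ltnW.
have lts (x : 'I_n) : x < size s by rewrite szs.
apply/and3P; split.
- apply/injectiveP => a b e.
  have : cell_of (tableau_of t) a = cell_of (tableau_of t) b by rewrite /cell_of e.
  rewrite !cell_tableau_of -/s => -[er ec]; apply: val_inj.
  case: (ltngtP a b) => // lt; have := ltn_count_take lt (les _).
    by rewrite ec er ltnn.
  by rewrite -ec -er ltnn.
- apply/forallP => a; rewrite cell_tableau_of -/s /=; apply/andP; split; apply/implyP.
    case E : (nth 0 s a) => [//|r] _ /=.
    have := bt a (lts a); rewrite E /addable /column /= !add0n => lt.
    have [b [ltba eb cb]] := count_take_ivt (les a) lt.
    have ltbn : b < n by apply: ltn_trans ltba _.
    apply/existsP; exists (Ordinal ltbn); rewrite cell_tableau_of -/s /=.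
    by rewrite eb cb.
  move=> c0; have [b [ltba eb cb]] := count_take_ivt (les a) (eq_leq (prednK c0)).
  have ltbn : b < n by apply: ltn_trans ltba _.
  apply/existsP; exists (Ordinal ltbn); rewrite cell_tableau_of -/s /=.
  by rewrite eb cb.
apply/forallP => a; apply/forallP => b; rewrite !cell_tableau_of -/s /=.
apply/andP; split; apply/implyP => /eqP[er ec]; rewrite ltnNge; apply/negP => le.
  by have := leq_count_take s (nth 0 s a) le; rewrite -er ec er ltnn.
have := bt b (lts b); rewrite er /addable /column [_ == 0]/= [_ < 0]/= [_.-1]/= !add0n => lt.
by have := leq_trans lt (leq_count_take s (nth 0 s a) le); rewrite -er ec ltnn.
Qed.

Lemma card_SYT n (P : pred {ffun 'I_n -> 'I_n * 'I_n}) (Q : pred (n.-tuple 'I_n)) :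
  (forall f, is_SYT f -> P f = Q (row_word f)) ->
  #|[set f | is_SYT f && P f]| = #|[set t : n.-tuple 'I_n | ballot (column 0) (map val t) && Q t]|.
Proof.
move=> PQ; rewrite -(card_in_imset (f := @row_word n)); last first.
  by move=> f g; rewrite !inE => /andP[fS _] /andP[gS _]; apply: row_word_inj.
apply: eq_card => t; rewrite !inE; apply/imsetP/andP => [[f]|[bt qt]].
  rewrite inE => /andP[fS Pf] ->; split; first exact: ballot_row_word.
  by rewrite -PQ.
exists (tableau_of t); last by rewrite tableau_ofK.
have tS := tableau_of_SYT bt; by rewrite inE tS PQ // tableau_ofK.
Qed.

(** The empty shape [column 0] has no downward path of positive length, so only j = 0 survives in
    [hermite]. *)
Lemma num_SYTE n : num_SYT n = invol n.
Proof.
transitivity #|[set f : {ffun 'I_n -> 'I_n * 'I_n} | is_SYT f && true]|.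
  by apply: eq_card => f; rewrite !inE andbT.
rewrite (card_SYT (Q := xpredT)) //.
transitivity (ups n n (column 0)).
  by rewrite -card_ballot; apply: eq_card => t; rewrite !inE andbT.
case: n => // n; rewrite (@ups_hermite n n.+1 0) //.
by rewrite -hermite_delta0; apply: eq_hermite => j; rewrite downs_column // leqn0.
Qed.

(** * Words of the favourable tableaux *)

Lemma incr_column r : incr r (column r) = column r.+1.
Proof. by apply: functional_extensionality => x; rewrite /incr /column; lia. Qed.

Lemma addable_column r i : 0 < r -> addable (column r) i = (i == 0) || (i == r).
Proof. by case: r => // r _; rewrite /addable /column; case: i => //= i; lia. Qed.

Lemma ballot_column r s : 0 < r -> 0 \notin s -> ballot (column r) s = (s == iota r (size s)).
Proof.
elim: s r => //= i s IH r r0; rewrite inE negb_or => /andP[i0 s0].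
rewrite addable_column // eqseq_cons [i == 0]eq_sym (negbTE i0) /=.
by case: eqP => //= ->; rewrite incr_column IH.
Qed.

Lemma ballot_iota m r : 0 < r -> ballot (column r) (iota r m).
Proof.
by move=> r0; rewrite ballot_column // ?size_iota // mem_iota; lia.
Qed.

Lemma foldl_incr_iota m r :
  foldl (fun l i => incr i l) (column r) (iota r m) = column (r + m).
Proof.
elim: m r => [|m IH] r /=; first by rewrite addn0.
by rewrite incr_column IH addSnnS.
Qed.

(** With k in this cell, the only 0 among the earlier letters is the first one; the letters after it
    can then only lengthen the first column. *)
Lemma entry_k12_prefix n k (f : {ffun 'I_n -> 'I_n * 'I_n}) : 1 < k <= n -> is_SYT f ->
  [exists a : 'I_n, (val a == k.-1) && (cell_of f a == (0, 1))]
  = prefix (iota 0 k.-1 ++ [:: 0]) (map val (row_word f)).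
Proof.
move=> /andP[k1 len] fS; set s := map val _.
have szs : size s = n by rewrite size_row_word.
have ltkn : k.-1 < n by lia.
have -> : [exists a : 'I_n, (val a == k.-1) && (cell_of f a == (0, 1))]
  = (nth 0 s k.-1 == 0) && (count_mem 0 (take k.-1 s) == 1).
  have E a : (cell_of f a == (0, 1)) = (nth 0 s a == 0) && (count_mem 0 (take a s) == 1).
    rewrite [cell_of f a]surjective_pairing xpair_eqE (SYT_col fS) -nth_row_word -/s.
    by case: eqP => // ->.
  apply/existsP/andP => [[a /andP[/eqP <-]]|e]; first by rewrite E => /andP.
  by exists (Ordinal ltkn); rewrite eqxx E /=; apply/andP.
have bs := ballot_row_word fS; rewrite -/s in bs.
case: k k1 len ltkn => // -[|k] // _ len ltkn /=.
case: s szs bs => [|x s] /=; first by move=> e; move: len; rewrite -e.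
move=> szs /andP[]; rewrite {1}/addable /column /= orbF => /eqP-> bs.
rewrite eqxx /= incr_column in bs *.
have ltks : k < size s by lia.
have -> : iota 1 k ++ [:: 0] = rcons (iota 1 k) 0 by rewrite cats1.
rewrite prefixE size_rcons size_iota (take_nth 0) // eqseq_rcons andbC; congr (_ && _).
rewrite add1n eqSS -leqn0 leqNgt -has_count has_pred1.
have [in0|ni0] := boolP (0 \in take k s).
  by apply/esym/negbTE/eqP => e; move: in0; rewrite e mem_iota.
move: bs; rewrite -{1}(cat_take_drop k s) ballot_cat => /andP[bt _]; move: bt.
by rewrite ballot_column // size_takel 1?ltnW // => ->.
Qed.

Lemma num_SYT_k12E m k : 1 < k ->
  num_SYT_k12 (m + k) k = hermite m (fun j => downs (m + k) j (hook k.-1)).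
Proof.
move=> k1; have le : 1 < k <= m + k by lia.
apply: etrans (card_SYT (fun f => entry_k12_prefix le)) _.
apply: etrans (card_ballot_prefix (m := m) (p := iota 0 k.-1 ++ [:: 0]) _ _ _) _.
- by rewrite size_cat size_iota /=; lia.
- by rewrite all_cat /= andbT; apply/andP; split; [apply/allP => i; rewrite mem_iota|]; lia.
- rewrite ballot_cat foldl_incr_iota; case: k k1 {le} => // -[|k] // _ /=.
  by rewrite incr_column ballot_iota.
rewrite foldl_cat foldl_incr_iota add0n /= -/(hook k.-1).
have [N eN] : exists N, m + k = N.+1 by exists (m + k).-1; lia.
rewrite eN; apply: (@ups_hermite N m k.-1).
- by move=> i; rewrite /hook /incr /column; lia.
- by move=> i; rewrite /hook /incr /column; lia.
- lia.
Qed.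

(** * Asymptotics *)

Lemma INR_addn m n : INR (m + n) = (INR m + INR n)%R.
Proof. exact: plus_INR. Qed.

Lemma INR_muln m n : INR (m * n) = (INR m * INR n)%R.
Proof. exact: mult_INR. Qed.

Lemma INR_subn m n : n <= m -> INR (m - n) = (INR m - INR n)%R.
Proof. by move=> /leP; apply: minus_INR. Qed.

Lemma leq_INR m n : m <= n -> (INR m <= INR n)%R.
Proof. by move=> /leP; apply: le_INR. Qed.

Lemma ltn_INR m n : m < n -> (INR m < INR n)%R.
Proof. by move=> /ltP; apply: lt_INR. Qed.

Lemma INR_fact_neq0 n : INR n`! <> 0%R.
Proof. by have := ltn_INR (fact_gt0 n); rewrite /=; lra. Qed.

Lemma INR_invol_gt0 n : (0 < INR (invol n))%R.
Proof. exact: (ltn_INR (invol_gt0 n)). Qed.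

Lemma INR_sum n (F : nat -> nat) :
  INR (\sum_(j < n.+1) F j) = sum_f_R0 (fun j => INR (F j)) n.
Proof.
elim: n => [|n IH]; first by rewrite big_ord1.
by rewrite big_ord_recr INR_addn IH.
Qed.

Lemma sqrt_INR_ge1 n : 0 < n -> (1 <= sqrt (INR n))%R.
Proof. by move=> /leq_INR h; rewrite -sqrt_1; apply: sqrt_le_1_alt. Qed.

Lemma sqrt_INR_sqr n : (sqrt (INR n) * sqrt (INR n) = INR n)%R.
Proof. by apply: sqrt_sqrt; apply: pos_INR. Qed.

(** Consecutive ratios satisfy rho' = 1 + (n+1)/rho, and this map sends [s, s+1] into [s', s'+1] for
    s = sqrt(n+1), s' = sqrt(n+2). *)
Lemma invol_ratio n :
  (sqrt (INR n.+1) * INR (invol n) <= INR (invol n.+1)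
   <= (sqrt (INR n.+1) + 1) * INR (invol n))%R.
Proof.
elim: n => [|n [lo hi]]; first by rewrite /= sqrt_1; lra.
rewrite [invol n.+2]involS [n.+1.-1]/= INR_addn INR_muln.
have x0 := INR_invol_gt0 n; have y0 := INR_invol_gt0 n.+1.
have s1 := @sqrt_INR_ge1 n.+1 isT; have s'1 := @sqrt_INR_ge1 n.+2 isT.
have ss := sqrt_INR_sqr n.+1; have ss' := sqrt_INR_sqr n.+2.
rewrite [INR n.+2]S_INR in ss' s'1 *; rewrite -[X in (_ + X * _)%R]ss.
rewrite -[X in (_ = X + 1)%R]ss in ss'.
set s := sqrt (INR n.+1) in lo hi s1 ss' *; set s' := sqrt (_ + 1) in s'1 ss' *.
set x := INR (invol n) in x0 lo hi *; set y := INR (invol n.+1) in y0 lo hi *.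
have less' : (s <= s')%R by nra.
(* This is s' <= 1 + s^2/(s+1), the lower bound obtained from rho <= s+1; the squares of the two
   sides differ by s^2. *)
have key : (s' * (s + 1) <= s * s + s + 1)%R.
  apply: Rsqr_incr_0_var; last by nra.
  rewrite /Rsqr.
  have -> : (s' * (s + 1) * (s' * (s + 1)) = (s' * s') * ((s + 1) * (s + 1)))%R by ring.
  rewrite ss'; nra.
split; last first.
  have : (s * (s * x) <= s' * y)%R by apply: Rmult_le_compat; nra.
  by lra.
have : ((s' - 1) * y <= (s' - 1) * ((s + 1) * x))%R by apply: Rmult_le_compat_l; lra.
have : ((s' * (s + 1)) * x <= (s * s + s + 1) * x)%R by apply: Rmult_le_compat_r; lra.
by nra.
Qed.

(** The relation f(n) = 1 + O(n^(-1/2)), a relative precision stable under products and inverses. *)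
Definition near1 (f : nat -> R) : Prop :=
  exists C N, (0 <= C)%R /\ forall n, N <= n -> (Rabs (f n - 1) <= C / sqrt (INR n))%R.

Lemma near1_ext N f g : (forall n, N <= n -> f n = g n) -> near1 f -> near1 g.
Proof.
move=> e [C [M [C0 h]]]; exists C, (maxn N M); split=> // n; rewrite geq_max => /andP[? ?].
by rewrite -e //; apply: h.
Qed.

Lemma Rdiv_sqrt_le C n : (0 <= C)%R -> 0 < n -> (0 <= C / sqrt (INR n) <= C)%R.
Proof.
move=> C0 /sqrt_INR_ge1 s1; have i0 : (0 < / sqrt (INR n))%R by apply: Rinv_0_lt_compat; lra.
have i1 : (/ sqrt (INR n) <= 1)%R by rewrite -Rinv_1; apply: Rinv_le_contravar; lra.
by rewrite /Rdiv; split; nra.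
Qed.

Lemma near1_mul f g : near1 f -> near1 g -> near1 (fun n => (f n * g n)%R).
Proof.
move=> [C [N [C0 hf]]] [D [M [D0 hg]]].
exists (C + D + C * D)%R, (maxn 1 (maxn N M)); split; first by nra.
move=> n; rewrite !geq_max => /and3P[n0 /hf {}hf /hg {}hg].
have [C1 C2] := Rdiv_sqrt_le C0 n0; have [D1 D2] := Rdiv_sqrt_le D0 n0.
have -> : (f n * g n - 1 = (f n - 1) * (g n - 1) + (f n - 1) + (g n - 1))%R by ring.
have -> : ((C + D + C * D) / sqrt (INR n) =
  C * (D / sqrt (INR n)) + C / sqrt (INR n) + D / sqrt (INR n))%R by rewrite /Rdiv; ring.
apply: Rle_trans (Rabs_triang _ _) _; apply: Rplus_le_compat => //.
apply: Rle_trans (Rabs_triang _ _) _; apply: Rplus_le_compat => //.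
rewrite Rabs_mult; apply: Rmult_le_compat; try exact: Rabs_pos; lra.
Qed.

Lemma near1_inv f : near1 f -> near1 (fun n => (/ f n)%R).
Proof.
move=> [C [N [C0 hf]]].
(* From 4C^2 <= n on, the error is at most 1/2, so f >= 1/2; the inverse then at most doubles the
   constant. *)
have [M hM] := INR_unbounded (4 * (C * C)).
exists (2 * C)%R, (maxn 1 (maxn N M)); split; first by nra.
move=> n; rewrite !geq_max => /and3P[n0 /hf {}hf /leq_INR leM].
have s1 := sqrt_INR_ge1 n0; have ss := sqrt_INR_sqr n.
have half : (C / sqrt (INR n) <= / 2)%R.
  apply: (Rmult_le_reg_r (sqrt (INR n))); first by lra.
  rewrite /Rdiv Rmult_assoc Rinv_l; last by lra.
  by nra.
have f2 : (/ 2 <= f n)%R by have := Rle_abs (- (f n - 1)); rewrite Rabs_Ropp; lra.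
have -> : (/ f n - 1 = - (f n - 1) * / f n)%R by field; lra.
rewrite Rabs_mult Rabs_Ropp [Rabs (/ f n)]Rabs_pos_eq; last first.
  by apply/Rlt_le/Rinv_0_lt_compat; lra.
have : (/ f n <= 2)%R by rewrite -[X in (_ <= X)%R]Rinv_inv; apply: Rinv_le_contravar; lra.
have i0 : (0 < / f n)%R by apply: Rinv_0_lt_compat; lra.
have := Rabs_pos (f n - 1).
have -> : (2 * C / sqrt (INR n) = C / sqrt (INR n) * 2)%R by rewrite /Rdiv; ring.
by move=> ? ?; apply: Rmult_le_compat; lra.
Qed.

Lemma near1_cst1 : near1 (fun=> 1%R).
Proof.
exists 0%R, 0; split; first lra.
by move=> n _; rewrite Rminus_diag Rabs_R0 /Rdiv Rmult_0_l; lra.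
Qed.

Lemma near1_sub c : near1 (fun n => INR (n - c) / INR n)%R.
Proof.
exists (INR c), (maxn 1 c); split; first exact: pos_INR.
move=> n; rewrite geq_max => /andP[n0 lec].
have s1 := sqrt_INR_ge1 n0; have ss := sqrt_INR_sqr n; have c0 := pos_INR c.
have np : (0 < INR n)%R by nra.
rewrite INR_subn //.
have -> : ((INR n - INR c) / INR n - 1 = - (INR c / INR n))%R by field; lra.
rewrite Rabs_Ropp Rabs_pos_eq; last by apply: Rmult_le_pos => //; apply/Rlt_le/Rinv_0_lt_compat.
by apply: Rmult_le_compat_l => //; apply: Rinv_le_contravar; nra.
Qed.

Lemma near1_ffact c j :
  near1 (fun n => INR ((n - c) ^_ j) / (sqrt (INR n) ^ (j + j)))%R.
Proof.
elim: j => [|j IH].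
  by apply: (near1_ext (N := 0)) near1_cst1 => n _; rewrite /= Rdiv_1_r.
apply: (near1_ext (N := 1)) (near1_mul IH (near1_sub (c + j))) => n n0.
have s1 := sqrt_INR_ge1 n0.
rewrite ffactnSr INR_muln -{2}(sqrt_INR_sqr n) addSn addnS subnDA /=.
by field; repeat split; try apply: pow_nonzero; lra.
Qed.

Lemma near1_invol_step c :
  near1 (fun n => INR (invol (n - c)) / (INR (invol (n - c.+1)) * sqrt (INR n)))%R.
Proof.
(* By [invol_ratio] the ratio lies in [u, u+1] with u = sqrt(n-c), and s - c <= u <= s for s = sqrt
   n; hence c + 1. *)
exists (INR c + 1)%R, c.+1; split; first by have := pos_INR c; lra.
move=> n ltcn; have n0 : 0 < n by apply: leq_ltn_trans ltcn.
have -> : n - c = (n - c.+1).+1 by lia.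
set p := n - c.+1; have [lo hi] := invol_ratio p.
have en : (INR n = INR p.+1 + INR c)%R by rewrite -INR_addn; congr INR; lia.
have s1 := sqrt_INR_ge1 n0; have u1 := @sqrt_INR_ge1 p.+1 isT.
have ss := sqrt_INR_sqr n; have uu := sqrt_INR_sqr p.+1; have x0 := INR_invol_gt0 p.
have c0 := pos_INR c.
have cc : (INR c <= INR c * INR c)%R.
  by rewrite -INR_muln; apply: leq_INR; case: (c) => // c'; rewrite leq_pmulr.
set s := sqrt (INR n) in s1 ss *; set u := sqrt (INR p.+1) in u1 uu lo hi.
set x := INR (invol p) in x0 lo hi *; set y := INR (invol p.+1) in lo hi *.
have us : (u <= s)%R by nra.
have su : (s <= u + INR c)%R by apply: Rsqr_incr_0_var; rewrite /Rsqr; nra.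
have -> : (y / (x * s) - 1 = (y / x - s) / s)%R by field; lra.
have yx : (u <= y / x <= u + 1)%R.
  by split; apply: (Rmult_le_reg_r x) => //; rewrite /Rdiv Rmult_assoc Rinv_l; nra.
rewrite /Rdiv Rabs_mult [Rabs (/ s)]Rabs_pos_eq; last by apply/Rlt_le/Rinv_0_lt_compat; lra.
apply: Rmult_le_compat_r; first by apply/Rlt_le/Rinv_0_lt_compat; lra.
by apply: Rabs_le; rewrite -/(Rdiv _ _); lra.
Qed.

Lemma near1_invol c :
  near1 (fun n => INR (invol n) / (INR (invol (n - c)) * sqrt (INR n) ^ c))%R.
Proof.
elim: c => [|c IH].
  apply: (near1_ext (N := 0)) near1_cst1 => n _; rewrite subn0 /=.
  by field; have := INR_invol_gt0 n; lra.
apply: (near1_ext (N := 1)) (near1_mul IH (near1_invol_step c)) => n n0 /=.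
have s1 := sqrt_INR_ge1 n0; have := INR_invol_gt0 (n - c); have := INR_invol_gt0 (n - c.+1).
by move=> ? ?; field; repeat split; try apply: pow_nonzero; lra.
Qed.

(** The quantity E_j with m = n - k. *)
Definition weight (k j n : nat) : R :=
  (INR ((n - k) ^_ j * invol (n - k - j)) / INR (invol n))%R.

(** The falling factorial contributes n^j and the quotient of involution numbers n^(-(k+j)/2). *)
Lemma near1_weight k j : j <= k ->
  near1 (fun n => weight k j n * sqrt (INR n) ^ (k - j))%R.
Proof.
move=> lejk.
apply: (near1_ext (N := 1)) (near1_mul (near1_ffact k j) (near1_inv (near1_invol (k + j)))).
move=> n n0; rewrite /weight INR_muln -subnDA.
have s1 := sqrt_INR_ge1 n0.
have e : (sqrt (INR n) ^ (k + j) = sqrt (INR n) ^ (k - j) * sqrt (INR n) ^ (j + j))%R.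
  by rewrite -pow_add; congr pow; rewrite -plusE; lia.
rewrite e; have := INR_invol_gt0 n; have := INR_invol_gt0 (n - (k + j)).
by move=> ? ?; field; repeat split; try apply: pow_nonzero; lra.
Qed.

(** * Errors of order n^(-2) and the expansion in weights *)

Definition bigO2 (f : nat -> R) : Prop :=
  exists C N, forall n, N <= n -> (Rabs (f n) <= C / INR n ^ 2)%R.

Lemma bigO2_add f g : bigO2 f -> bigO2 g -> bigO2 (fun n => f n + g n)%R.
Proof.
move=> [C [N hf]] [D [M hg]]; exists (C + D)%R, (maxn N M) => n.
rewrite geq_max => /andP[/hf {}hf /hg {}hg].
by rewrite Rdiv_plus_distr; apply: Rle_trans (Rabs_triang _ _) _; lra.
Qed.

Lemma bigO2_scale c f : bigO2 f -> bigO2 (fun n => c * f n)%R.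
Proof.
move=> [C [N hf]]; exists (Rabs c * C)%R, N => n /hf {}hf.
rewrite Rabs_mult /Rdiv Rmult_assoc; apply: Rmult_le_compat_l => //.
exact: Rabs_pos.
Qed.

Lemma bigO2_sum p (f : nat -> nat -> R) : (forall j, j <= p -> bigO2 (f j)) ->
  bigO2 (fun n => sum_f_R0 (fun j => f j n) p).
Proof.
elim: p => [|p IH] h; first exact: h.
by apply: bigO2_add; [apply: IH => j le; apply: h; apply: leqW | apply: h].
Qed.

Lemma bigO2_weight k j : j + 4 <= k -> bigO2 (weight k j).
Proof.
move=> le; have [|C [N [C0 h]]] := @near1_weight k j; first lia.
exists (C + 1)%R, (maxn 1 N) => n; rewrite geq_max => /andP[n0 /h {}h].
have s1 := sqrt_INR_ge1 n0; have [_ CC] := Rdiv_sqrt_le C0 n0.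
set s := sqrt (INR n) in s1 h CC.
have p0 : (0 < s ^ (k - j))%R by apply: pow_lt; lra.
have le4 : (s ^ 4 <= s ^ (k - j))%R by apply: Rle_pow => //; lia.
have -> : (INR n ^ 2 = s ^ 4)%R by rewrite -(sqrt_INR_sqr n) -/s; ring.
have s4 : (0 < s ^ 4)%R by apply: pow_lt; lra.
apply: (Rmult_le_reg_r (s ^ 4)) => //.
rewrite /Rdiv Rmult_assoc Rinv_l ?Rmult_1_r; last by lra.
apply: Rle_trans (_ : Rabs (weight k j n * s ^ (k - j)) <= _)%R.
  rewrite Rabs_mult [Rabs (s ^ _)]Rabs_pos_eq; last by lra.
  by apply: Rmult_le_compat_l => //; apply: Rabs_pos.
have -> : (weight k j n * s ^ (k - j) = (weight k j n * s ^ (k - j) - 1) + 1)%R by ring.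
by apply: Rle_trans (Rabs_triang _ _) _; rewrite Rabs_R1; lra.
Qed.

(** A relative error O(n^(-1/2)) on n^(-3/2) is an absolute error O(n^(-2)). *)
Lemma bigO2_weight3 q :
  bigO2 (fun n => weight (q + 3) q n - / Rpower (INR n) (3 / 2))%R.
Proof.
have [|C [N [C0 h]]] := @near1_weight (q + 3) q; first lia.
rewrite addKn in h.
exists C, (maxn 1 N) => n; rewrite geq_max => /andP[n0 /h {}h].
have s1 := sqrt_INR_ge1 n0.
have n0' : (0 < INR n)%R by apply: (ltn_INR n0).
have -> : (Rpower (INR n) (3 / 2) = sqrt (INR n) ^ 3)%R.
  have -> : (3 / 2 = 1 + / 2)%R by field.
  rewrite Rpower_plus Rpower_1 // Rpower_sqrt // -{1}(sqrt_INR_sqr n); ring.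
set s := sqrt (INR n) in s1 h *.
have -> : (INR n ^ 2 = s ^ 4)%R by rewrite -(sqrt_INR_sqr n) -/s; ring.
have s3 : (0 < / s ^ 3)%R by apply/Rinv_0_lt_compat/pow_lt; lra.
have -> : (weight (q + 3) q n - / s ^ 3 = (weight (q + 3) q n * s ^ 3 - 1) * / s ^ 3)%R.
  by field; lra.
have -> : (C / s ^ 4 = C / s * / s ^ 3)%R by field; lra.
rewrite Rabs_mult [Rabs (/ _)]Rabs_pos_eq; last by lra.
by apply: Rmult_le_compat_r => //; lra.
Qed.

Lemma hermite_weight k (a : nat -> nat) n : k + k <= n -> (forall j, k < j -> a j = 0) ->
  (INR (hermite (n - k) a) / INR (invol n)
   = sum_f_R0 (fun j => INR (a j) / INR j`! * weight k j n) k)%R.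
Proof.
move=> le a0; rewrite (@hermite_trunc _ k) //; last lia.
rewrite (INR_sum _ (fun j => 'C(n - k, j) * a j * invol (n - k - j))).
rewrite /Rdiv Rmult_comm scal_sum; apply: sum_eq => j _.
rewrite /weight -bin_ffact !INR_muln.
have := INR_invol_gt0 n => ?; have := @INR_fact_neq0 j => ?.
by field; split=> //; lra.
Qed.

Lemma INR_ffact k j : j <= k -> INR (k ^_ j) = (INR k`! / INR (k - j)`!)%R.
Proof.
move=> le; rewrite -(ffact_fact le) INR_muln; field; exact: INR_fact_neq0.
Qed.

Theorem theorem4 (k : nat) (hk : (3 <= k)%nat) :
  exists C : R, exists N : nat, forall n : nat, (N <= n)%nat ->
    (Rabs (prob_k12 n k
           - (INR (k - 1) / INR (k`!)
              + (INR k - 4) / (3 * INR ((k - 3)`!)) * / Rpower (INR n) (3 / 2)))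
     <= C / (INR n ^ 2))%R.
Proof.
have [q ek] : exists q, k = q + 3 by exists (k - 3); lia.
(* [a] holds the downward counts of the hook, [b] the coefficients of the expansion of 1 from
   [invol_add], [c] the limit; [d] is what remains after subtracting c times that expansion. *)
pose a j := if j < k.-1 then j.+1 else if j <= k then k.-1 else 0.
pose b j := k ^_ j * invol (k - j).
pose c := (INR (k - 1) / INR (k`!))%R.
pose d j := (INR (a j) / INR j`! - c * (INR (b j) / INR j`!))%R.
have probE n : k + k <= n ->
    (prob_k12 n k - c = sum_f_R0 (fun j => d j * weight k j n) k)%R.
  move=> le; have en : n = (n - k) + k by lia.
  have -> : prob_k12 n k = (INR (hermite (n - k) a) / INR (invol n))%R.
    rewrite /prob_k12 num_SYTE {1}en num_SYT_k12E -?en //; last by lia.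
    congr (INR _ / _)%R; apply: eq_hermite => j.
    by rewrite downs_hook /a ?prednK //; lia.
  have one : (INR (hermite (n - k) b) / INR (invol n) = 1)%R.
    rewrite /b -invol_add -en; field.
    by have := INR_invol_gt0 n; lra.
  rewrite -[X in (_ - X)%R]Rmult_1_r -one !hermite_weight //; first last.
  - by move=> j lt; rewrite /a; case: ifP; [lia|]; case: ifP => //; lia.
  - by move=> j lt; rewrite /b ffact_small.
  rewrite scal_sum -minus_sum; apply: sum_eq => j _; rewrite /d; ring.
(* The k! in [c] cancels against (k)_j = k!/(k-j)!, where k - j = 3 - r. *)
have dE r : r <= 3 -> d (q + r) =
    (INR (a (q + r)%nat) / INR (q + r)`! - INR (q + 2) * INR (invol (3 - r))
      / (INR (3 - r)`! * INR (q + r)`!))%R.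
  move=> ler; rewrite /d /b /c INR_muln INR_ffact; last by lia.
  have -> : k - (q + r) = 3 - r by lia.
  have -> : k - 1 = q + 2 by lia.
  by field; repeat split; exact: INR_fact_neq0.
(* For the top three indices a_j = k-1, and t_i = i! for i = 0, 1, 2, so the two parts of [d]
   agree. *)
have d3 : d (q + 3) = 0%R.
  rewrite dE // /a ek; have -> : (q + 3 < (q + 3).-1) = false by lia.
  rewrite leqnn; have -> : (q + 3).-1 = q + 2 by lia.
  by rewrite /=; field; exact: INR_fact_neq0.
have d2 : d (q + 2) = 0%R.
  rewrite dE // /a ek; have -> : (q + 2 < (q + 3).-1) = false by lia.
  have -> : q + 2 <= q + 3 by lia.
  have -> : (q + 3).-1 = q + 2 by lia.
  by rewrite /=; field; exact: INR_fact_neq0.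
have d1 : d (q + 1) = 0%R.
  rewrite dE // /a ek; have -> : q + 1 < (q + 3).-1 by lia.
  have -> : (q + 1).+1 = q + 2 by lia.
  have -> : INR (invol (3 - 1)) = 2%R by rewrite /=; ring.
  by field; exact: INR_fact_neq0.
(* Here a_j = k-2 while t_3/3! = 4/6, and k - 2 - (2/3)(k-1) = (k-4)/3. *)
have d0 : d q = ((INR k - 4) / (3 * INR (k - 3)`!))%R.
  rewrite -[q in LHS]addn0 dE // addn0 /a ek addnK.
  have -> : q < (q + 3).-1 by lia.
  have -> : INR (invol (3 - 0)) = 4%R by rewrite /=; ring.
  have -> : INR (3 - 0)`! = 6%R by rewrite /=; ring.
  rewrite -addn1 !INR_addn /=.
  by field; exact: INR_fact_neq0.
have main : bigO2 (fun n => sum_f_R0 (fun j => d j * weight k j n) q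
                            - d q * / Rpower (INR n) (3 / 2))%R.
  have top : bigO2 (fun n => d q * (weight k q n - / Rpower (INR n) (3 / 2)))%R.
    by apply: bigO2_scale; rewrite ek; apply: bigO2_weight3.
  (* For q = 0 the main term stands alone; otherwise the terms below q have k - j >= 4 and go into
     the error. *)
  case: (q) ek top => [|p] ek' [C [N h]] /=.
    by exists C, N => n /h; rewrite Rmult_minus_distr_l.
  have [C' [N' h']] : bigO2 (fun n => sum_f_R0 (fun j => d j * weight k j n) p
      + d p.+1 * (weight k p.+1 n - / Rpower (INR n) (3 / 2)))%R.
    apply: bigO2_add; last by exists C, N.
    apply: (@bigO2_sum p (fun j n => d j * weight k j n)%R) => j le.
    by apply: bigO2_scale; apply: bigO2_weight; lia.
  by exists C', N' => n /h'; rewrite Rmult_minus_distr_l /Rminus Rplus_assoc.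
have [C [N h]] := main.
exists C, (maxn (k + k) N) => n; rewrite geq_max => /andP[/probE pE /h {}h].
rewrite -/c -d0.
have -> : (prob_k12 n k - (c + d q * / Rpower (INR n) (3 / 2))
  = (prob_k12 n k - c) - d q * / Rpower (INR n) (3 / 2))%R by ring.
rewrite pE; move: d1 d2 d3; rewrite [in X in sum_f_R0 _ X]ek !addnS addn0 /= => -> -> ->.
by rewrite !Rmult_0_l !Rplus_0_r.
Qed.
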